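(* Let $M_1,\dots,M_n$ be DFAs over a common alphabet $\Sigma$, and let $G$ be the labeled graph constructed from them as described in the context. Then $\bigcup_{i=1}^n L(M_i)=\Sigma^*$ if and only if $X_G$ is a shift of finite type.
   Context: A labeled graph has finite vertex and edge sets, edges with initial/terminal vertices and labels; loops and multiple edges allowed. $X_G$ is the set of label sequences of bi-infinite paths in $G$. A shift of finite type is a set $\{x\in A^{\mathbb Z}:\text{no word of }\mathcal F\text{ appears in }x\}$ for a finite alphabet $A$ and a finite set of words $\mathcal F$. A DFA $M_i$ has finite state set $Q_i$ (pairwise disjoint), total transition function $\delta_i\colon Q_i\times\Sigma\to Q_i$ (viewed as edges $q\to\delta_i(q,a)$ labeled $a$), initial state $s_i$, accepting set $F_i$; $L(M_i)=\{w\in\Sigma^*:\delta_i(s_i,w)\in F_i\}$. Let $\star,\ell,\lhd,\rhd$ be distinct symbols not in $\Sigma$. $G$: a vertex $t$ with a self loop labeled $\star$; a vertex $s^*$ with a self loop labeled $a$ for each $a\in\Sigma\cup\{\ell\}$ and an edge labeled $\rhd$ from $s^*$ to $t$; for each $i$, embed $M_i$, add for each $q\in Q_i$ an edge labeled $\lhd$ from $q$ to $s_i$ and a self loop labeled $\ell$ at $q$, and for each $q\in F_i$ an edge labeled $\rhd$ from $q$ to $t$. *)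

(* Defs.v *)
From HB Require Import structures.
From mathcomp Require Import all_boot all_order all_algebra.
From mathcomp Require Import boolp classical_sets cardinality.

Set Implicit Arguments.
Unset Strict Implicit.
Unset Printing Implicit Defensive.

Import GRing.Theory.
Local Open Scope ring_scope.
Local Open Scope classical_set_scope.

Section Shifts.
Variable B : Type.

Record labeled_graph := LabeledGraph {
  lg_vertex : finType;
  lg_edge : finType;
  lg_src : lg_edge -> lg_vertex;
  lg_tgt : lg_edge -> lg_vertex;
  lg_label : lg_edge -> B }.

Definition biinfinite_path (G : labeled_graph) (e : int -> lg_edge G) : Prop :=
  forall k : int, lg_tgt (e k) = lg_src (e (k + 1)).

Definition graph_shift (G : labeled_graph) : set (int -> B) :=
  [set x | exists2 e : int -> lg_edge G,
             biinfinite_path e & x = (fun k => lg_label (e k))].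

Definition appears_in (w : seq B) (x : int -> B) : Prop :=
  exists k : int, w = mkseq (fun j => x (k + j%:Z)) (size w).

(* A^Z is represented as the set of x : int -> B with all values in a finite
   set A of symbols of B. *)
Definition shift_of_finite_type (X : set (int -> B)) : Prop :=
  exists (A : set B) (F : set (seq B)),
    [/\ finite_set A, finite_set F &
        X = [set x | (forall k, A (x k)) /\
                     (forall w, F w -> ~ appears_in w x)]].

End Shifts.

Record dfa (Sigma : finType) := Dfa {
  dfa_state : finType;
  dfa_trans : dfa_state -> Sigma -> dfa_state;
  dfa_init : dfa_state;
  dfa_accept : {set dfa_state} }.

Definition dfa_lang (Sigma : finType) (M : dfa Sigma) : set (seq Sigma) :=
  [set w | foldl (@dfa_trans _ M) (dfa_init M) w \in dfa_accept M].

Inductive symbol (Sigma : Type) : Type :=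
  | Letter of Sigma
  | Star
  | Ell
  | Lhd
  | Rhd.
Arguments Star {Sigma}.
Arguments Ell {Sigma}.
Arguments Lhd {Sigma}.
Arguments Rhd {Sigma}.

Section Construction.
Variables (Sigma : finType) (n : nat) (M : 'I_n -> dfa Sigma).

Definition ustate : finType := {i : 'I_n & dfa_state (M i)}.

Definition utrans (q : ustate) (a : Sigma) : ustate :=
  Tagged (fun i => dfa_state (M i)) (dfa_trans (tagged q) a).
Definition uinit (q : ustate) : ustate :=
  Tagged (fun i => dfa_state (M i)) (dfa_init (M (tag q))).
Definition uaccept (q : ustate) : bool := tagged q \in dfa_accept (M (tag q)).

Inductive gvertex : Type :=
  | V_t
  | V_s
  | V_state of ustate.

Inductive gedge : Type :=
  | E_t_star
  | E_s_letter of Sigma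
  | E_s_ell
  | E_s_rhd
  | E_trans of ustate & Sigma
  | E_lhd of ustate
  | E_ell of ustate
  | E_rhd of {q : ustate | uaccept q}.

Definition gsrc (e : gedge) : gvertex :=
  match e with
  | E_t_star => V_t
  | E_s_letter _ => V_s
  | E_s_ell => V_s
  | E_s_rhd => V_s
  | E_trans q _ => V_state q
  | E_lhd q => V_state q
  | E_ell q => V_state q
  | E_rhd q => V_state (val q)
  end.

Definition gtgt (e : gedge) : gvertex :=
  match e with
  | E_t_star => V_t
  | E_s_letter _ => V_s
  | E_s_ell => V_s
  | E_s_rhd => V_t
  | E_trans q a => V_state (utrans q a)
  | E_lhd q => V_state (uinit q)
  | E_ell q => V_state q
  | E_rhd _ => V_t
  end.

Definition glabel (e : gedge) : symbol Sigma :=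
  match e with
  | E_t_star => Star
  | E_s_letter a => Letter a
  | E_s_ell => Ell
  | E_s_rhd => Rhd
  | E_trans _ a => Letter a
  | E_lhd _ => Lhd
  | E_ell _ => Ell
  | E_rhd _ => Rhd
  end.

Definition gvertex_code (v : gvertex) : bool + ustate :=
  match v with
  | V_t => inl true
  | V_s => inl false
  | V_state q => inr q
  end.
Definition gvertex_decode (c : bool + ustate) : gvertex :=
  match c with
  | inl true => V_t
  | inl false => V_s
  | inr q => V_state q
  end.
Lemma gvertex_codeK : cancel gvertex_code gvertex_decode.
Proof. by case. Qed.

HB.instance Definition _ := Finite.copy gvertex (can_type gvertex_codeK).

Definition gedge_type : finType :=
  ('I_3 + Sigma + (ustate * Sigma) + (ustate + ustate)
   + {q : ustate | uaccept q})%type.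

Definition gedge_code (e : gedge) : gedge_type :=
  match e with
  | E_t_star => inl (inl (inl (inl (inord 0))))
  | E_s_ell => inl (inl (inl (inl (inord 1))))
  | E_s_rhd => inl (inl (inl (inl (inord 2))))
  | E_s_letter a => inl (inl (inl (inr a)))
  | E_trans q a => inl (inl (inr (q, a)))
  | E_lhd q => inl (inr (inl q))
  | E_ell q => inl (inr (inr q))
  | E_rhd q => inr q
  end.
Definition gedge_decode (c : gedge_type) : gedge :=
  match c with
  | inl (inl (inl (inl j))) =>
      match val j with
      | 0%N => E_t_star
      | 1%N => E_s_ell
      | _ => E_s_rhd
      end
  | inl (inl (inl (inr a))) => E_s_letter a
  | inl (inl (inr (q, a))) => E_trans q a
  | inl (inr (inl q)) => E_lhd q
  | inl (inr (inr q)) => E_ell q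
  | inr q => E_rhd q
  end.
Lemma gedge_codeK : cancel gedge_code gedge_decode.
Proof. by case=> //=; rewrite inordK. Qed.

HB.instance Definition _ := Finite.copy gedge (can_type gedge_codeK).

Definition dfas_graph : labeled_graph (symbol Sigma) :=
  @LabeledGraph (symbol Sigma) gvertex gedge gsrc gtgt glabel.

End Construction.

(* Main.v *)
(** A point of the shift is admissible when [Star] occurs exactly after [Star]
or [Rhd].  Every point of the shift is admissible.  Conversely, the transition
functions being total, Koenig's lemma provides a run of any automaton on any
bi-infinite sequence, and the only obstruction to turning it into a path is that
the run must be in an accepting state when it meets [Rhd].  This happens for a
suitable automaton if the languages cover all words, so admissibility, a
condition on words of length two, then defines the shift.  If a word [w] is
rejected by all automata, the sequence [... Ell Ell Lhd Ell^N w Rhd Star Star ...]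
is not in the shift, although all its factors of length at most [N] occur in
points of the shift. *)

Require Import Defs.
From mathcomp Require Import all_boot all_order all_algebra.
From mathcomp Require Import boolp classical_sets cardinality.
From mathcomp Require Import zify.

Set Implicit Arguments.
Unset Strict Implicit.
Unset Printing Implicit Defensive.

Import Order.TTheory GRing.Theory Num.Theory.
Local Open Scope ring_scope.
Local Open Scope classical_set_scope.

(** * Integer offsets and a pigeonhole principle *)

Lemma int_lt_exists (a b : int) :
  (a < b)%R -> exists j : nat, b = a + 1 + j%:Z.
Proof. by move=> lt_ab; exists (absz (b - a - 1)%R); lia. Qed.

(** If every [q] failed at some [f q], no [q] could work at the maximum of [f], since [P q] is
    closed downwards. *)
Lemma finite_pigeonhole (Q : finType) (P : Q -> nat -> Prop) :
  (forall q m m', (m' <= m)%N -> P q m -> P q m') ->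
  (forall m, exists q, P q m) -> exists q, forall m, P q m.
Proof.
move=> Pdown Pex; apply: contrapT => noq.
have /choice[f fP] : forall q, exists m, ~ P q m.
  move=> q; apply: contrapT => Nq; apply: noq; exists q => m.
  by apply: contrapT => NP; apply: Nq; exists m.
have [q qP] := Pex (\max_q f q)%N.
by apply: (fP q); apply: Pdown qP; apply: leq_bigmax.
Qed.

(** * Koenig's lemma and bi-infinite runs *)

Section InverseLimit.
Variables (Q : finType) (g : nat -> Q -> Q).

Fixpoint iter_from (n m : nat) (r : Q) : Q :=
  if m is m'.+1 then g n (iter_from n.+1 m' r) else r.

Lemma iter_fromD n m k r :
  iter_from n (m + k) r = iter_from n m (iter_from (n + m) k r).
Proof.
elim: m n => [|m IH] n /=; first by rewrite addn0.
by rewrite IH addSnnS.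
Qed.

(** The nodes with ancestors at every depth, among which the infinite branch is chosen. *)
Definition deep_image n q := forall m, exists r, iter_from n m r = q.

Lemma iter_from_down n m m' q : (m' <= m)%N ->
  (exists r, iter_from n m r = q) -> exists r, iter_from n m' r = q.
Proof.
by move=> le_m [r <-]; rewrite -(subnKC le_m) iter_fromD; eexists.
Qed.

(** For each depth some preimage of [q] reaches that far back; by pigeonhole one preimage serves all
    depths. *)
Lemma deep_image_pred n q :
  deep_image n q -> exists r, deep_image n.+1 r /\ g n r = q.
Proof.
move=> dq; have [||r rP] := @finite_pigeonhole Q
    (fun r m => (exists r0, iter_from n.+1 m r0 = r) /\ g n r = q).
- by move=> r m m' le_m [/(iter_from_down le_m)].
- move=> m; have [r <-] := dq m.+1.
  by exists (iter_from n.+1 m r); split=> //; exists r.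
by exists r; split=> [m|]; [have [] := rP m | have [] := rP 0%N].
Qed.

Lemma backward_orbit (q0 : Q) : exists p : nat -> Q, forall n, p n = g n (p n.+1).
Proof.
have [||q dq] := @finite_pigeonhole Q (fun q m => exists r, iter_from 0 m r = q).
- by move=> q m m'; apply: iter_from_down.
- by move=> m; exists (iter_from 0 m q0), q0.
have /choice[h hP] : forall nq : nat * Q, exists r,
    deep_image nq.1 nq.2 -> deep_image nq.1.+1 r /\ g nq.1 r = nq.2.
  move=> [n r] /=; have [/deep_image_pred[r' ?]|ndr] := pselect (deep_image n r).
    by exists r'.
  by exists r.
pose p := fix p n := if n is n'.+1 then h (n', p n') else q.
have pP n : deep_image n (p n).
  by elim: n => [|n IH] //=; have [] := hP (n, p n) IH.
by exists p => n; have [_ /= ->] := hP (n, p n) (pP n).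
Qed.

End InverseLimit.

Lemma biinfinite_orbit (Q : finType) (q0 : Q) (f : int -> Q -> Q) :
  exists q : int -> Q, forall k, q (k + 1) = f k (q k).
Proof.
have [p pP] := backward_orbit (fun n => f (Negz n)) q0.
(* The future is plain recursion; [p n] is the state at position [-n], and the halves meet at
   [p 0]. *)
pose r := fix r n := if n is n'.+1 then f (Posz n') (r n') else p 0%N.
exists (fun k => match k with Posz j => r j | Negz j => p j.+1 end).
case=> [j|[|j]].
- by have -> : Posz j + 1 = Posz j.+1 by lia.
- exact: (pP 0%N).
- have -> : Negz j.+1 + 1 = Negz j by lia.
  exact: (pP j.+1).
Qed.

(** * Admissible sequences and the action of symbols on states *)

Section Points.
Variables (Sigma : finType).
Implicit Types (x : int -> symbol Sigma) (D : dfa Sigma).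

Definition admissible_pair (a b : symbol Sigma) := b = Star <-> a = Star \/ a = Rhd.

Definition admissible x := forall k, admissible_pair (x k) (x (k + 1)).

Lemma admissible_after x k j :
  admissible x -> x k = Rhd -> x (k + 1 + j%:Z) = Star.
Proof.
move=> adm xk; elim: j => [|j IH].
  by rewrite addr0; apply/adm; right.
have -> : k + 1 + j.+1%:Z = k + 1 + j%:Z + 1 by lia.
by apply/adm; left.
Qed.

Lemma admissible_lt x k m : admissible x -> x k = Rhd -> x m <> Star ->
  (m <= k)%R.
Proof.
move=> adm xk xm; have [//|/int_lt_exists[j mE]] := lerP m k.
by case: xm; rewrite mE admissible_after.
Qed.

(* [Star] and [Rhd] act as the identity, so that the action is total. *)
Definition sym_trans D (q : dfa_state D) (a : symbol Sigma) : dfa_state D :=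
  match a with
  | Letter b => dfa_trans q b
  | Lhd => dfa_init D
  | _ => q
  end.

(** Collects the letters read since the last [Lhd]. It mentions no automaton, so the word is known
    before an automaton accepting it is chosen. *)
Definition word_step (w : seq Sigma) (a : symbol Sigma) : seq Sigma :=
  match a with
  | Letter b => rcons w b
  | Lhd => [::]
  | _ => w
  end.

Lemma foldl_sym_trans D (s : seq (symbol Sigma)) :
  foldl (@sym_trans D) (dfa_init D) s =
  foldl (@dfa_trans _ D) (dfa_init D) (foldl word_step [::] s).
Proof.
elim/last_ind: s => [|s a IH] //=; rewrite !foldl_rcons IH.
by case: a => //= b; rewrite foldl_rcons.
Qed.

Lemma foldl_sym_trans_Letter D q (w : seq Sigma) :
  foldl (@sym_trans D) q (map (@Letter _) w) = foldl (@dfa_trans _ D) q w.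
Proof. by elim: w q => [|a w IH] q //=. Qed.

Lemma foldl_sym_trans_Ell D q N : foldl (@sym_trans D) q (nseq N Ell) = q.
Proof. by elim: N. Qed.

Lemma foldl_mkseq (T : Type) (f : T -> symbol Sigma -> T) x (q : int -> T) k j :
  (forall i, q (i + 1) = f (q i) (x i)) ->
  q (k + j%:Z) = foldl f (q k) (mkseq (fun i : nat => x (k + i%:Z)) j).
Proof.
move=> qP; elim: j => [|j IH]; first by rewrite addr0.
rewrite mkseqS foldl_rcons -IH -qP; congr q; lia.
Qed.

Lemma nth_plain N (w : seq Sigma) j :
  let s := nseq N Ell ++ map (@Letter _) w in
  (j < size s)%N ->
  nth Star s j <> Star /\ nth Star s j <> Rhd /\ nth Star s j <> Lhd.
Proof.
rewrite /= size_cat size_nseq size_map nth_cat size_nseq nth_nseq => js.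
case: ltnP => // Nj; have jw : (j - N < size w)%N by lia.
by case: w jw {js} => // a w jw; rewrite (nth_map a).
Qed.

(** * Points and paths of the graph *)

Section Graph.
Variables (n : nat) (M : 'I_n -> dfa Sigma).
Local Notation G := (dfas_graph M).

Definition V_of i (q : dfa_state (M i)) : gvertex M :=
  V_state (Tagged (fun i => dfa_state (M i)) q).

(** The edges ending at [V_t] are those labeled [Star] or [Rhd], and the edges starting there are
    those labeled [Star]. *)
Lemma graph_shift_admissible x : graph_shift G x -> admissible x.
Proof.
move=> [e eP ->] k /=; have := eP k => /=.
by case: (e k) => [|?|||??|?|?|?]; case: (e (k + 1)) => [|?|||??|?|?|?] //= _;
  split=> //; do ?[by case]; do ?[by left]; do ?[by right].
Qed.

Definition s_edge (a : symbol Sigma) : gedge M :=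
  match a with
  | Letter b => E_s_letter M b
  | Ell => E_s_ell M
  | Rhd => E_s_rhd M
  | _ => E_t_star M
  end.

(** The path stays at [V_s] up to [Rhd], then at [V_t]. *)
Lemma graph_shift_no_Lhd x :
  admissible x -> (forall k, x k <> Lhd) -> graph_shift G x.
Proof.
move=> adm noL; exists (s_edge \o x) => [k|] /=; last first.
  by apply/funext => k; have := noL k; case: (x k).
have := adm k; have := noL (k + 1); have := noL k; rewrite /admissible_pair.
case: (x k) => [?|||//|] _; case: (x (k + 1)) => [?|||//|] _ //= [h1 h2];
  by [have := h2 (or_introl erefl)
     | have := h2 (or_intror erefl)
     | have [] := h1 erefl].
Qed.

(** The fallback [E_t_star] at [Rhd] only serves non-accepting states, which [graph_shift_run]
    excludes. *)
Definition state_edge i (q : dfa_state (M i)) (a : symbol Sigma) : gedge M :=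
  let u : ustate M := Tagged (fun i => dfa_state (M i)) q in
  match a with
  | Letter b => E_trans u b
  | Ell => E_ell u
  | Lhd => E_lhd u
  | Rhd => if insub u is Some r then E_rhd r else E_t_star M
  | Star => E_t_star M
  end.

Lemma graph_shift_run x i (q : int -> dfa_state (M i)) :
  admissible x -> (forall k, q (k + 1) = sym_trans (q k) (x k)) ->
  (forall k, x k = Rhd -> q k \in dfa_accept (M i)) -> graph_shift G x.
Proof.
move=> adm qP acc.
have RhdE k : x k = Rhd -> exists2 r : {u : ustate M | uaccept u},
    val r = Tagged (fun i => dfa_state (M i)) (q k) & state_edge (q k) Rhd = E_rhd r.
  move=> xk.
  have qk : uaccept (Tagged (fun i => dfa_state (M i)) (q k)) by apply: acc.
  by exists (Sub _ qk); rewrite ?SubK //= insubT.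
have srcE k : x k <> Star -> gsrc (state_edge (q k) (x k)) = V_of (q k).
  by case xk: (x k) => // _; have [r rE ->] := RhdE k xk; rewrite /= rE.
exists (fun k => state_edge (q k) (x k)) => [k|] /=; last first.
  by apply/funext => k; case xk: (x k) => //; have [r _ ->] := RhdE k xk.
(* After a letter, [Ell] or [Lhd] the next symbol is not [Star], so the next edge starts at the next
   state of the run; after [Star] or [Rhd] it is [Star], and the edges meet at [V_t]. *)
have := adm k; rewrite /admissible_pair; case xk: (x k) => [a||||] [h1 h2];
  do ?[have xk1 : x (k + 1) <> Star by move=> /h1[]];
  try by rewrite srcE // qP xk.
- by rewrite h2 //; left.
- have [r _ ->] := RhdE k xk; by rewrite h2 //; right.
Qed.

Lemma graph_shift_no_Rhd x : (0 < n)%N ->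
  admissible x -> (forall k, x k <> Rhd) -> graph_shift G x.
Proof.
move=> n_gt0 adm noR; pose i := Ordinal n_gt0.
have [q qP] := biinfinite_orbit (dfa_init (M i)) (fun k q => sym_trans q (x k)).
by apply: (graph_shift_run adm qP) => k /noR.
Qed.

Lemma graph_shift_universal x : (0 < n)%N ->
  \bigcup_(i in [set: 'I_n]) dfa_lang (M i) = [set: seq Sigma] ->
  admissible x -> graph_shift G x.
Proof.
move=> n_gt0 cover adm.
have [[m xm]|noL] := pselect (exists m, x m = Lhd); last first.
  by apply: graph_shift_no_Lhd => // k xk; apply: noL; exists k.
have [[k xk]|noR] := pselect (exists k, x k = Rhd); last first.
  by apply: graph_shift_no_Rhd => // k xk; apply: noR; exists k.
have /int_lt_exists[j kE] : (m < k)%R.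
  rewrite lt_neqAle (admissible_lt adm xk) ?xm // andbT.
  by apply/eqP => mk; rewrite mk xk in xm.
(* The segment strictly between [Lhd] and [Rhd]. It may contain further [Lhd]; [word_step] keeps the
   letters after the last one. *)
pose s := mkseq (fun i : nat => x (m + 1 + i%:Z)) j.
have [i _ wP] : (\bigcup_(i in [set: 'I_n]) dfa_lang (M i)) (foldl word_step [::] s).
  by rewrite cover.
have [q qP] := biinfinite_orbit (dfa_init (M i)) (fun k q => sym_trans q (x k)).
apply: (graph_shift_run adm qP) => k' xk'.
(* Only [Star] follows [Rhd], so [Rhd] occurs once and acceptance has to be checked only there. *)
have -> : k' = k.
  by apply/le_anti; rewrite !(admissible_lt adm) ?xk ?xk'.
rewrite kE (foldl_mkseq _ _ qP) qP xm /= foldl_sym_trans.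
exact: wP.
Qed.

Lemma gtgt_state (e : gedge M) i (q : dfa_state (M i)) :
  gsrc e = V_of q -> glabel e <> Rhd ->
  gtgt e = V_of (sym_trans q (glabel e)).
Proof. by case: e => [|?|||u a|u|u|u] //= [uE] // _; rewrite uE. Qed.

Lemma path_follow (e : int -> gedge M) (s : seq (symbol Sigma)) k i
    (q : dfa_state (M i)) :
  biinfinite_path (G := G) e -> gsrc (e k) = V_of q ->
  (forall j, (j < size s)%N ->
     glabel (e (k + j%:Z)) = nth Star s j /\ nth Star s j <> Rhd) ->
  gsrc (e (k + (size s)%:Z)) = V_of (foldl (@sym_trans _) q s).
Proof.
move=> eP; elim: s k q => [|a s IH] k q srck sP /=; first by rewrite addr0.
have [] := sP 0%N isT; rewrite addr0 /= => labk aR.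
have -> : k + (size s).+1%:Z = k + 1 + (size s)%:Z by lia.
apply: IH => [|j js].
  by rewrite -[LHS]eP /= -labk; apply: gtgt_state; rewrite // labk.
have -> : k + 1 + j%:Z = k + j.+1%:Z by lia.
exact: sP.
Qed.

(** An edge labeled [Lhd] leads to the initial state of some automaton; from there the path is
    determined by its labels, and it can leave by [Rhd] only from an accepting state. *)
Lemma path_Lhd_word_Rhd (e : int -> gedge M) N (w : seq Sigma) k :
  let s := nseq N Ell ++ map (@Letter _) w in
  biinfinite_path (G := G) e -> glabel (e k) = Lhd ->
  (forall j, (j < size s)%N -> glabel (e (k + 1 + j%:Z)) = nth Star s j) ->
  glabel (e (k + 1 + (size s)%:Z)) = Rhd ->
  (\bigcup_(i in [set: 'I_n]) dfa_lang (M i)) w.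
Proof.
move=> s eP labk sP labR.
have [i srcE] : exists i, gsrc (e (k + 1)) = V_of (dfa_init (M i)).
  by have := eP k => /=; case: (e k) labk => //= u _ <-; exists (tag u).
have sR j (js : (j < size s)%N) : nth Star s j <> Rhd.
  by have [_ []] := nth_plain js.
have := @path_follow e s (k + 1) i _ eP srcE (fun j js => conj (sP j js) (sR j js)).
rewrite foldl_cat foldl_sym_trans_Ell foldl_sym_trans_Letter.
case: (e _) labR => // r _ [rE].
by exists i => //; have := valP r; rewrite /= rE.
Qed.

End Graph.

(** * A sequence outside the shift with all short factors inside *)

Section Witness.
Variables (N : nat) (w : seq Sigma).

(** The [N.+1] copies of [Ell] fill positions [0] to [N], so that [N] of them remain once [Lhd] is
    put at [0]. The default of [nth] supplies the tail of [Star]. *)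
Definition word_then_Rhd (k : int) : symbol Sigma :=
  if k is Posz j then nth Star (rcons (nseq N.+1 Ell ++ map (@Letter _) w) Rhd) j
  else Ell.

Definition lone_Lhd (k : int) : symbol Sigma := if k == 0 then Lhd else Ell.

Definition Lhd_word_then_Rhd (k : int) : symbol Sigma :=
  if k == 0 then Lhd else word_then_Rhd k.

Lemma word_then_Rhd_admissible : admissible word_then_Rhd.
Proof.
case=> [j|[|j]]; last 2 first.
- by split=> //; case.
- have -> : Negz j.+1 + 1 = Negz j by lia.
  by split=> //; case.
rewrite -PoszD addn1 /word_then_Rhd /admissible_pair !nth_rcons.
case: (ltngtP j (size _)) => [jl|jl|->].
- case: (ltngtP j.+1 (size _)) => [jl'|jl'|_].
  + by have [? _] := nth_plain jl'; have [? [? _]] := nth_plain jl; split=> // -[].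
  + by rewrite ltnNge jl in jl'.
  + by have [? [? _]] := nth_plain jl; split=> // -[].
- by rewrite ltnNge (leqW (ltnW jl)) /= (gtn_eqF (leqW jl)); split=> // _; left.
- by rewrite ltnNge leqnSn /= (gtn_eqF (ltnSn _)); split=> // _; right.
Qed.

Lemma word_then_Rhd_no_Lhd k : word_then_Rhd k <> Lhd.
Proof.
case: k => [j|j] //; rewrite /word_then_Rhd nth_rcons.
by case: ltngtP => // /nth_plain[_ []].
Qed.

Lemma lone_Lhd_admissible : admissible lone_Lhd.
Proof.
by move=> k; rewrite /admissible_pair /lone_Lhd; do 2 case: ifP => _; split=> // -[].
Qed.

Lemma lone_Lhd_no_Rhd k : lone_Lhd k <> Rhd.
Proof. by rewrite /lone_Lhd; case: ifP. Qed.

(** A factor that covers position [0] ends before position [N], hence sees only [Lhd] and [Ell]; any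
    other factor misses the [Lhd]. *)
Lemma Lhd_word_then_Rhd_factor (v : seq (symbol Sigma)) : (size v <= N)%N ->
  appears_in v Lhd_word_then_Rhd ->
  appears_in v word_then_Rhd \/ appears_in v lone_Lhd.
Proof.
move=> vN [k vE].
have [in0|out0] := boolP ((k <= 0) && (0 < k + (size v)%:Z))%R; [right|left];
  exists k; rewrite {1}vE; apply/eq_in_map => j; rewrite mem_iota => jv;
  rewrite /Lhd_word_then_Rhd; last by rewrite ifF //; lia.
rewrite /lone_Lhd; case: eqP => // kj; case kjE: (k + j%:Z) => [l|l] //=.
case: l kjE => [|l] kjE //=.
rewrite nth_rcons size_cat size_nseq size_map ifT; last by lia.
by rewrite nth_cat size_nseq nth_nseq ifT ?ifT //; lia.
Qed.

Lemma Lhd_word_then_Rhd_notin n (M : 'I_n -> dfa Sigma) :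
  graph_shift (dfas_graph M) Lhd_word_then_Rhd ->
  (\bigcup_(i in [set: 'I_n]) dfa_lang (M i)) w.
Proof.
move=> [e eP xE].
have lab k : glabel (e k) = Lhd_word_then_Rhd k by rewrite xE.
have shift (i : nat) : 0 + 1 + i%:Z = Posz i.+1 by lia.
apply: (path_Lhd_word_Rhd (N := N) (k := 0) eP) => [|j js|].
- by rewrite lab.
- by rewrite lab shift /word_then_Rhd /Lhd_word_then_Rhd /= nth_rcons js.
- by rewrite lab shift /word_then_Rhd /Lhd_word_then_Rhd /= nth_rcons ltnn eqxx.
Qed.

End Witness.

End Points.

(** * Bounded forbidden words and the equivalence *)

Lemma finite_words_bounded (B : Type) (F : set (seq B)) :
  finite_set F -> exists N, forall w, F w -> (size w <= N)%N.
Proof.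
move=> /(finite_image size)/finite_seqP[r rE].
exists (\max_(i <- r) i)%N => w Fw; apply: leq_bigmax_seq => //.
by have : (size @` F) (size w) by [exists w]; rewrite rE.
Qed.

Theorem theorem4p16 (Sigma : finType) (n : nat) (hn : (0 < n)%N)
    (M : 'I_n -> dfa Sigma) :
  \bigcup_(i in [set: 'I_n]) dfa_lang (M i) = [set: seq Sigma] <->
  shift_of_finite_type (graph_shift (dfas_graph M)).
Proof.
split=> [cover|[A [F [_ /finite_words_bounded[N FN] XE]]]].
  (* Forbidden pairs are indexed by edges, which form a finite type; with the edge labels as
     alphabet, every pair of symbols arises this way. *)
  pose bad := [set p : gedge M * gedge M |
    ~ admissible_pair (glabel p.1) (glabel p.2)].
  exists (range (@glabel _ _ M)), [set [:: glabel p.1; glabel p.2] | p in bad].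
  split; [exact: finite_image | exact: finite_image |].
  apply/seteqP; split=> x.
    move=> Xx; split=> [k|w [p badp <-] [k [pE1 pE2]]].
      by case: Xx => e _ ->; exists (e k).
    by apply: badp; rewrite /= pE1 pE2 addr0; apply: graph_shift_admissible Xx k.
  move=> [Ax Fx]; apply: graph_shift_universal => // k.
  have [e _ eE] := Ax k; have [e' _ e'E] := Ax (k + 1).
  apply: contrapT => nadm; apply: (Fx [:: x k; x (k + 1)]).
    by exists (e, e'); rewrite /bad /= eE e'E.
  by exists k; rewrite /= /mkseq /= addr0.
(* With [N] bounding the forbidden words, the combined sequence satisfies all constraints because
   its symbols and short factors occur in two points of the shift. It is thus a point itself, which
   forces [w] to be accepted. *)
apply/seteqP; split=> // w _; apply: (@Lhd_word_then_Rhd_notin _ N).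
have := graph_shift_no_Lhd M (@word_then_Rhd_admissible _ N w)
  (@word_then_Rhd_no_Lhd _ N w).
have := graph_shift_no_Rhd M hn (@lone_Lhd_admissible _) (@lone_Lhd_no_Rhd _).
rewrite XE => -[Az Fz] [Ay Fy]; split=> [k|v Fv].
  rewrite /Lhd_word_then_Rhd; case: ifP => _; last exact: Ay.
  exact: (Az 0).
by move=> /(Lhd_word_then_Rhd_factor (FN v Fv))[/(Fy v Fv)|/(Fz v Fv)].
Qed.
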